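(* The problem of deciding, given a graph $G$, whether $G$ has an m-convex $2$-cover is solvable in polynomial time.
   Context: Graphs are finite, undirected, without loops or multiple edges. A path is induced if no edge joins two nonconsecutive vertices of the path. A set $S\subseteq V(G)$ is m-convex (monophonically convex) if for every induced path of $G$ whose two end-vertices belong to $S$, all vertices of the path belong to $S$. An m-convex $2$-cover of $G$ is a pair of m-convex sets $V_1,V_2$, each different from $V(G)$, such that $V_1\cup V_2=V(G)$. *)

(* Defs.v *)
From mathcomp Require Import all_boot.

Set Implicit Arguments.
Unset Strict Implicit.
Unset Printing Implicit Defensive.

Section MonophonicConvexity.
Variables (T : finType) (e : rel T).

(* The path with vertex sequence x :: p; the path reduced to x is allowed. *)
Definition induced_path (x : T) (p : seq T) : Prop :=
  [/\ path e x p, uniq (x :: p) &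
      forall i j, i.+1 < j -> j < size (x :: p) ->
        ~~ e (nth x (x :: p) i) (nth x (x :: p) j)].

Definition m_convex (S : {set T}) : Prop :=
  forall (x : T) (p : seq T), induced_path x p ->
    x \in S -> last x p \in S -> {subset x :: p <= S}.

Definition has_m_convex_2cover : Prop :=
  exists V1 V2 : {set T},
    [/\ m_convex V1, m_convex V2, V1 != setT, V2 != setT & V1 :|: V2 = setT].

End MonophonicConvexity.

(* As instances of a computational problem, graphs have vertices 0, ..., n-1. *)
Record graph := Graph {
  nvert : nat;
  adj : rel 'I_nvert;
  adj_sym : symmetric adj;
  adj_irr : irreflexive adj }.

(* The adjacency matrix in row-major order, a word of length (nvert G) ^ 2. *)
Definition graph_code (G : graph) : seq bool :=
  [seq adj i j | i <- enum 'I_(nvert G), j <- enum 'I_(nvert G)].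

(* A random access machine with a register file and an indirectly addressed   *)
(* memory, both holding natural numbers, each instruction costing one step.   *)
(* The arithmetic is limited to addition and truncated subtraction: after t   *)
(* steps, numbers have O(t + log N) bits on inputs of length N, so that unit  *)
(* cost is polynomially related to the running time of Turing machines.       *)
Inductive instr :=
| IConst (d c : nat)     (* r[d] := c                   *)
| IAdd (d a b : nat)     (* r[d] := r[a] + r[b]         *)
| ISub (d a b : nat)     (* r[d] := max(r[a] - r[b], 0) *)
| IRead (d a : nat)      (* r[d] := m[r[a]]             *)
| IWrite (a s : nat)     (* m[r[a]] := r[s]             *)
| IJump0 (a l : nat).    (* if r[a] = 0 then goto l     *)

Definition program := seq instr.

Record config := Config {
  pc : nat;
  regs : nat -> nat;
  cells : nat -> nat }.

Definition exec (i : instr) (s : config) : config :=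
  let: Config q r m := s in
  match i with
  | IConst d c => Config q.+1 [eta r with d |-> c] m
  | IAdd d a b => Config q.+1 [eta r with d |-> r a + r b] m
  | ISub d a b => Config q.+1 [eta r with d |-> r a - r b] m
  | IRead d a => Config q.+1 [eta r with d |-> m (r a)] m
  | IWrite a v => Config q.+1 r [eta m with r a |-> r v]
  | IJump0 a l => Config (if r a == 0 then l else q.+1) r m
  end.

(* The machine halts when the program counter leaves the program. *)
Definition halted (P : program) (s : config) : bool := size P <= pc s.

Definition step (P : program) (s : config) : config :=
  if onth P (pc s) is Some i then exec i s else s.

(* The input word is in the first memory cells and its length in register 0;  *)
(* everything else is 0.                                                      *)
Definition init (w : seq bool) : config :=
  Config 0 [eta (fun=> 0) with 0 |-> size w] (fun i => nth false w i).

(* A halted machine accepts if register 0 is nonzero and rejects otherwise.   *)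
Definition accepting (s : config) : bool := regs s 0 != 0.

(* The problem with instances in I, encoded by enc, and yes-instances Q is    *)
(* decided by a single program in time polynomial in the encoding length.     *)
Definition polytime_decidable (I : Type) (enc : I -> seq bool)
    (Q : I -> Prop) : Prop :=
  exists (P : program) (c k : nat), forall x : I,
    exists2 t, t <= c * size (enc x) ^ k + c &
      let s := iter t (step P) (init (enc x)) in
      halted P s /\ (accepting s <-> Q x).

(* Main.v *)
Require Import Defs.
From mathcomp Require Import all_boot zify.

Set Implicit Arguments.
Unset Strict Implicit.
Unset Printing Implicit Defensive.

(* Let x and y be called far if they are distinct and nonadjacent. If the      *)
(* convex hull H of some far vertices u, v is not the whole vertex set, then   *)
(* the neighbors in H of a component K of the complement of H form a clique,   *)
(* which does not contain both u and v, and K together with this clique, and   *)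
(* the complement of K, form an m-convex 2-cover. If all these hulls are the   *)
(* whole vertex set, then proper m-convex sets are cliques, and a cover exists *)
(* if and only if the complement of the graph is bipartite and there are at    *)
(* least two vertices. A set S is m-convex if and only if it contains every    *)
(* common neighbor x of some a in S and of some component of G - N[a] meeting  *)
(* S; hence hulls, like these components and the walks of even length in the   *)
(* complement of the graph, are given by a least fixpoint over n^3 triples of  *)
(* vertices, computed by iterating polynomially many rounds in place.          *)

(** * Compiling loops to the machine *)

(** Suppose proper m-convex sets [V1], [V2] cover the graph. If one of them contains far vertices u
    and v, it contains their hull, which is then proper; otherwise both are cliques, and membership
    in [V1] is a proper 2-colouring of the complement graph. Conversely, a proper hull yields a
    cover by cutting along a clique separator ([m_convex_2cover_of_proper], resting on
    [m_convex_clique_boundary]), and a 2-colouring of the complement yields a cover by two cliques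
    ([m_convex_2cover_of_bipartite]). This is [has_m_convex_2coverP], where hulls and even walks are
    expressed by [derivable]; [derivable_sound] and [hull_convex] show that the facts of kind 1 are
    exactly the hulls.

    The least fixpoint ranges over 3n^3 facts, so 3n^3 rounds of rule application reach it
    ([sem_Saturate]). The algorithm is written as a term of a small loop language whose loops all
    run up to the same unchanged bound. The cost of a term is therefore a polynomial in that bound
    ([cost_poly]), and [code_correct] compiles terms within this cost. The input reveals only the
    length n^2, so a first term extracts the root n ([val_Root]) before the main term runs;
    [polytime_machine] assembles the two. *)

Definition runs (P : program) (s s' : config) (T : nat) : Prop :=
  exists2 t, t <= T & iter t (step P) s = s'.

Lemma runs_refl P s : runs P s s 0.
Proof. by exists 0. Qed.

Lemma runs_trans P s1 s2 s3 T1 T2 :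
  runs P s1 s2 T1 -> runs P s2 s3 T2 -> runs P s1 s3 (T1 + T2).
Proof.
move=> [t1 le1 <-] [t2 le2 <-]; exists (t2 + t1); last by rewrite iterD.
by rewrite addnC leq_add.
Qed.

Lemma runs_leq P s s' T T' : T <= T' -> runs P s s' T -> runs P s s' T'.
Proof. by move=> leT [t let_ <-]; exists t => //; apply: leq_trans leT. Qed.

Definition code_at (P : program) (p : nat) (c : program) : Prop :=
  forall k, k < size c -> onth P (p + k) = onth c k.

Lemma code_at_cat P p c1 c2 : code_at P p (c1 ++ c2) ->
  code_at P p c1 /\ code_at P (p + size c1) c2.
Proof.
move=> cP; split=> k ltk.
  by rewrite cP ?size_cat ?ltn_addr // onth_cat ltk.
rewrite -addnA cP ?size_cat ?ltn_add2l // onth_cat ltnNge leq_addr /=.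
by rewrite addKn.
Qed.

Lemma code_at_cons P p i c : code_at P p (i :: c) ->
  onth P p = Some i /\ code_at P p.+1 c.
Proof.
move=> cP; split; first by rewrite -[p]addn0 cP.
by move=> k ltk; rewrite addSnnS cP.
Qed.

Lemma runs_step P i c p r m s' T : code_at P p (i :: c) ->
    (code_at P p.+1 c -> runs P (exec i (Config p r m)) s' T) ->
  runs P (Config p r m) s' T.+1.
Proof.
case/code_at_cons => Pp cP /(_ cP) [t let_ <-]; exists t.+1 => //.
by rewrite iterSr /step /= Pp.
Qed.

Lemma code_at_self pre c post : code_at (pre ++ c ++ post) (size pre) c.
Proof. by move=> k ltk; rewrite !onth_cat ltnNge leq_addr /= addKn ltk. Qed.

(* Sum v a is the loop adding up the values of a for register v.+2 running    *)
(* through 0, ..., r[1] - 1; as Inc a b adds b to the memory cell a and has   *)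
(* value 0, Add and Sum also serve as sequential composition and for-loop.    *)
Inductive term :=
| Var (x : nat)
| Cst (c : nat)
| Add (a b : term)
| Sub (a b : term)
| Get (a : term)
| Inc (a b : term)
| Sum (v : nat) (a : term).

Fixpoint sem (e : term) (r m : nat -> nat) : nat * (nat -> nat) :=
  match e with
  | Var x => (r x, m)
  | Cst c => (c, m)
  | Add a b => let s := sem a r m in let t := sem b r s.2 in (s.1 + t.1, t.2)
  | Sub a b => let s := sem a r m in let t := sem b r s.2 in (s.1 - t.1, t.2)
  | Get a => let s := sem a r m in (s.2 s.1, s.2)
  | Inc a b => let s := sem a r m in let t := sem b r s.2 in
      (0, [eta t.2 with s.1 |-> t.1 + t.2 s.1] : nat -> nat)
  | Sum v a =>
      iteri (r 1) (fun i s => let t := sem a [eta r with v.+2 |-> i] s.2 in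
                              (s.1 + t.1, t.2)) (0, m)
  end.

Fixpoint regs_below (d : nat) (e : term) : bool :=
  match e with
  | Var x => x < d
  | Cst c => true
  | Add a b | Sub a b | Inc a b => regs_below d a && regs_below d b
  | Get a => regs_below d a
  | Sum v a => (v.+2 < d) && regs_below d a
  end.

Lemma regs_belowW d d' e : d <= d' -> regs_below d e -> regs_below d' e.
Proof.
move=> led; elim: e => //= [x|a IHa b IHb|a IHa b IHb|a IHa b IHb|v a IHa].
- by move=> /leq_trans; apply.
- by case/andP=> /IHa -> /IHb.
- by case/andP=> /IHa -> /IHb.
- by case/andP=> /IHa -> /IHb.
- by case/andP=> /leq_trans -> // /IHa.
Qed.

(** Compiled code leaves debris in registers from d on; this shows that the debris does not
    influence later subterms. The bound [1 < d] protects register 1, which every loop reads. *)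
Lemma sem_ext d e r r' m : 1 < d -> regs_below d e ->
  (forall j, j < d -> r j = r' j) -> sem e r m = sem e r' m.
Proof.
move=> d_gt1.
elim: e r r' m => //=
    [x|a IHa b IHb|a IHa b IHb|a IHa|a IHa b IHb|v a IHa] r r' m.
- by move=> ltx ->.
- by case/andP=> va vb Err; rewrite (IHa _ r') // (IHb _ r').
- by case/andP=> va vb Err; rewrite (IHa _ r') // (IHb _ r').
- by move=> va Err; rewrite (IHa _ r').
- by case/andP=> va vb Err; rewrite (IHa _ r') // (IHb _ r').
case/andP=> _ va Err; rewrite (Err 1) //.
elim: (r' 1) => //= k ->.
rewrite (IHa _ [eta r' with v.+2 |-> k]) // => j ltj /=.
by case: eqP => // _; rewrite Err.
Qed.

(** Jump targets are absolute, so code lengths must be known before the code is generated. *)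
Fixpoint len (e : term) : nat :=
  match e with
  | Var _ => 2
  | Cst _ => 1
  | Add a b | Sub a b => len a + len b + 1
  | Get a => len a + 1
  | Inc a b => len a + len b + 4
  | Sum v a => len a + 12
  end.

(* The value of e goes to register d, and no register below d is changed; p   *)
(* is the address of the first instruction.                                   *)
Fixpoint code (e : term) (d p : nat) : program :=
  match e with
  | Var x => [:: IConst d 0; IAdd d x d]
  | Cst c => [:: IConst d c]
  | Add a b => code a d p ++ code b d.+1 (p + len a) ++ [:: IAdd d d d.+1]
  | Sub a b => code a d p ++ code b d.+1 (p + len a) ++ [:: ISub d d d.+1]
  | Get a => code a d p ++ [:: IRead d d]
  | Inc a b => code a d p ++ code b d.+1 (p + len a) ++
      [:: IRead d.+2 d; IAdd d.+1 d.+1 d.+2; IWrite d d.+1; IConst d 0]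
  | Sum v a =>
      [:: IConst d 0; IAdd d.+1 v.+2 d; IConst v.+2 0;
          ISub d.+2 1 v.+2; IJump0 d.+2 (p + 10 + len a)] ++
      code a d.+2 (p + 5) ++
      [:: IAdd d d d.+2; IConst d.+2 1; IAdd v.+2 v.+2 d.+2; IConst d.+2 0;
          IJump0 d.+2 (p + 3); IConst d.+2 0; IAdd v.+2 d.+1 d.+2]
  end.

Lemma size_code e d p : size (code e d p) = len e.
Proof.
by elim: e d p => //= [a IHa b IHb|a IHa b IHb|a IHa|a IHa b IHb|v a IHa] d p;
  rewrite ?size_cat /= ?IHa ?IHb; lia.
Qed.

(** In a loop, 3 steps initialize, each round adds 7 steps of testing and bookkeeping to the body,
    and the final failed test with the restoration of the loop register takes 4. *)
Fixpoint cost (B : nat) (e : term) : nat :=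
  match e with
  | Var _ => 2
  | Cst _ => 1
  | Add a b | Sub a b => cost B a + (cost B b + 1)
  | Get a => cost B a + 1
  | Inc a b => cost B a + (cost B b + 4)
  | Sum v a => 3 + B * (cost B a + 7) + 4
  end.

Definition computes P d p p' r m (x : nat) (m' : nat -> nat) (T : nat) : Prop :=
  exists r', [/\ runs P (Config p r m) (Config p' r' m') T, r' d = x &
                 forall j, j < d -> r' j = r j].

(** Induction on the term: registers from d on serve as a stack of intermediate values, so nothing
    below d is lost. A loop borrows register [v.+2] below d and must restore it. *)
Lemma code_correct P e d p r m : 1 < d -> regs_below d e ->
    code_at P p (code e d p) ->
  computes P d p (p + len e) r m (sem e r m).1 (sem e r m).2 (cost (r 1) e).
Proof.
(* The common prefix of [Add], [Sub] and [Inc]: the value of a waits in register d while b is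
   evaluated into d+1. *)
have binop a b i d0 p0 r0 m0 :
    (forall d p r m, 1 < d -> regs_below d a -> code_at P p (code a d p) ->
  computes P d p (p + len a) r m (sem a r m).1 (sem a r m).2 (cost (r 1) a)) ->
    (forall d p r m, 1 < d -> regs_below d b -> code_at P p (code b d p) ->
  computes P d p (p + len b) r m (sem b r m).1 (sem b r m).2 (cost (r 1) b)) ->
    1 < d0 -> regs_below d0 a && regs_below d0 b ->
    code_at P p0 (code a d0 p0 ++ code b d0.+1 (p0 + len a) ++ i) ->
    let s := sem a r0 m0 in let t := sem b r0 s.2 in
    exists r', [/\ runs P (Config p0 r0 m0) (Config (p0 + len a + len b) r' t.2)
                     (cost (r0 1) a + cost (r0 1) b),
                 r' d0 = s.1, r' d0.+1 = t.1 &
                 forall j, j < d0 -> r' j = r0 j] /\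
      code_at P (p0 + len a + len b) i.
  move=> IHa IHb d_gt1 /andP[va vb] /code_at_cat[ca]; rewrite size_code.
  case/code_at_cat=> cb; rewrite size_code => ci s t.
  have [r1 [run1 r1d r1j]] := IHa d0 p0 r0 m0 d_gt1 va ca.
  have vb' : regs_below d0.+1 b by apply: regs_belowW vb.
  have [r2 [run2 r2d r2j]] := IHb d0.+1 _ r1 s.2 (ltnW d_gt1) vb' cb.
  have sE : sem b r1 s.2 = t by apply: (@sem_ext d0).
  rewrite sE in run2 r2d; rewrite (r1j 1) // in run2.
  exists r2; split=> //; split=> //; first exact: runs_trans run1 run2.
    by rewrite r2j.
  by move=> j ltj; rewrite r2j 1?ltnW // r1j.
elim: e d p r m => [x|c|a IHa b IHb|a IHa b IHb|a IHa|a IHa b IHb|v a IHa] d p r m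
  d_gt1 /=.
- move=> ltx cP; exists [eta [eta r with d |-> 0] with d |-> r x].
  split=> /=; [|by rewrite eqxx|by move=> j ltj; rewrite !(ltn_eqF ltj)].
  apply: (runs_step cP) => {}cP; apply: (runs_step cP) => _ /=.
  rewrite (ltn_eqF ltx) eqxx addn0 addn2; exact: runs_refl.
- move=> _ cP; exists [eta r with d |-> c].
  split=> /=; [|by rewrite eqxx|by move=> j ltj; rewrite !(ltn_eqF ltj)].
  apply: (runs_step cP) => _ /=; rewrite addn1; exact: runs_refl.
- move=> vab /(binop _ _ _ _ _ r m IHa IHb d_gt1 vab).
  case=> r1 [[run1 r1d r1d1 r1j] cP].
  eexists; split.
  + rewrite [cost _ _ + _]addnA; apply: runs_trans run1 _.
    apply: (runs_step cP) => _ /=; rewrite !addnA addn1; exact: runs_refl.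
  + by rewrite /= eqxx r1d r1d1.
  + by move=> j ltj; rewrite /= (ltn_eqF ltj) r1j.
- move=> vab /(binop _ _ _ _ _ r m IHa IHb d_gt1 vab).
  case=> r1 [[run1 r1d r1d1 r1j] cP].
  eexists; split.
  + rewrite [cost _ _ + _]addnA; apply: runs_trans run1 _.
    apply: (runs_step cP) => _ /=; rewrite !addnA addn1; exact: runs_refl.
  + by rewrite /= eqxx r1d r1d1.
  + by move=> j ltj; rewrite /= (ltn_eqF ltj) r1j.
- move=> va /code_at_cat[ca]; rewrite size_code => cP.
  have [r1 [run1 r1d r1j]] := IHa d p r m d_gt1 va ca.
  eexists; split.
  + apply: runs_trans run1 _.
    apply: (runs_step cP) => _ /=; rewrite addnA addn1; exact: runs_refl.
  + by rewrite /= eqxx r1d.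
  + by move=> j ltj; rewrite /= (ltn_eqF ltj) r1j.
- move=> vab /(binop _ _ _ _ _ r m IHa IHb d_gt1 vab).
  case=> r1 [[run1 r1d r1d1 r1j] cP].
  exists [eta [eta [eta r1 with d.+2 |-> (sem b r (sem a r m).2).2 (r1 d)] with
    d.+1 |-> r1 d.+1 + (sem b r (sem a r m).2).2 (r1 d)] with d |-> 0]; split.
  + rewrite [cost _ _ + _]addnA; apply: runs_trans run1 _.
    do 4![apply: (runs_step cP) => {}cP] => /=.
    rewrite !eqxx /= -r1d -r1d1.
    have -> : (d == d.+1) = false by lia.
    have -> : (d == d.+2) = false by lia.
    have -> : (d.+1 == d.+2) = false by lia.
    rewrite !addnA addn4; exact: runs_refl.
  + by rewrite /= eqxx.
  + by move=> j ltj; rewrite /= !ltn_eqF ?r1j //; lia.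
case/andP=> ltv va /(@code_at_cat _ _ [:: _; _; _; _; _]) /= [cP].
case/code_at_cat=> ca; rewrite size_code => cQ.
pose S k := iteri k (fun i s => let t := sem a [eta r with v.+2 |-> i] s.2 in
                              (s.1 + t.1, t.2)) (0, m).
have va' : regs_below d.+2 a by apply: regs_belowW va; lia.
(* Loop invariant after k rounds: register d holds the partial sum, d+1 the saved old content of the
   loop register, and the loop register holds k. *)
pose inv k (q : nat -> nat) := [/\ q d = (S k).1, q d.+1 = r v.+2, q v.+2 = k &
   forall j, j < d -> j != v.+2 -> q j = r j].
have cL : code_at P (p + 3) [:: ISub d.+2 1 v.+2; IJump0 d.+2 (p + 10 + len a)].
  by move=> k ltk; rewrite -addnA cP //; move: k ltk; do 3![case=> //].
have dE : ((d == d.+1) = false) * ((d == d.+2) = false) * ((d.+1 == d.+2) = false)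
  * ((d.+2 == d) = false)* ((d.+1 == d) = false)* ((v.+2 == d) = false) *
    ((v.+2 == d.+1) = false) * ((v.+2 == d.+2) = false) *
    ((d == v.+2) = false) * ((d.+1 == v.+2) = false) * ((d.+2 == v.+2) = false).
  by repeat split; lia.
have loop k : k <= r 1 -> exists q, inv k q /\
   runs P (Config p r m) (Config (p + 3) q (S k).2) (3 + k * (cost (r 1) a + 7)).
  elim: k => [|k IHk] lek.
    exists [eta [eta [eta r with d |-> 0] with d.+1 |-> r v.+2] with v.+2 |-> 0].
    split.
      split=> /=; rewrite ?eqxx ?if_same //.
      + by rewrite !dE.
      + by rewrite !dE.
      + by move=> j ltj /negPf->; rewrite !ltn_eqF //; lia.
    do 3![apply: (runs_step cP) => {}cP] => /=.
    rewrite eqxx dE addn0 addn3; exact: runs_refl.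
  have [q [[qd qd1 qv qj] run]] := IHk (ltnW lek).
  have q1 : q 1 = r 1 by rewrite qj.
  pose q0 : nat -> nat := [eta q with d.+2 |-> r 1 - k].
  have [q2 [run2 q2d q2j]] := IHa d.+2 (p + 5) q0 (S k).2 isT va' ca.
  have sE : sem a q0 (S k).2 = sem a [eta r with v.+2 |-> k] (S k).2.
    apply: (@sem_ext d) => // j ltj; rewrite /q0 /= [j == d.+2]ltn_eqF; last by lia.
    by case: eqP => [->|/eqP jv]; [exact: qv|rewrite qj].
  rewrite sE in q2d run2.
  have q01 : q0 1 = r 1 by rewrite /= -q1.
  rewrite q01 in run2.
  have S1 : S k.+1 = ((S k).1 + q2 d.+2, (sem a [eta r with v.+2 |-> k] (S k).2).2).
    by rewrite q2d.
  eexists; split; last first.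
  have -> : 3 + k.+1 * (cost (r 1) a + 7) =
     (3 + k * (cost (r 1) a + 7)) + (1 + (1 + (cost (r 1) a + 5))) by lia.
  apply: runs_trans run _.
  have cL' := cL; apply: (runs_step cL') => {}cL'; apply: (runs_step cL') => {}cL' /=.
  have -> : (if d.+2 == d.+2 then q 1 - q v.+2 else q d.+2) == 0 = false.
    by rewrite eqxx qv q1; lia.
  have -> : (p + 3).+2 = p + 5 by lia.
  rewrite q1 qv; apply: runs_trans run2 _.
  have cR := cQ; do 4![apply: (runs_step cR) => {}cR].
  apply: (runs_step cR) => _ /=; rewrite ?eqxx /= ?dE ?eqxx.
  exact: runs_refl.
  split=> /=; rewrite ?eqxx ?dE ?S1 /=.
  - by rewrite q2j // /q0 /= dE qd q2d.
  - by rewrite q2j // /q0 /= dE qd1.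
  - by rewrite q2j /q0 /= ?dE ?qv ?addn1 //; lia.
  - move=> j ltj jv; rewrite (negPf jv) !ltn_eqF ?q2j /q0 /=; try lia.
    by rewrite ltn_eqF ?qj //; lia.
have [q [[qd qd1 qv qj] run]] := loop _ (leqnn _).
rewrite -[iteri _ _ _]/(S (r 1)).
(* The exit jump lands on the last two instructions of the block after the body, which restore the
   loop register. *)
have cE : code_at P (p + 10 + len a) [:: IConst d.+2 0; IAdd v.+2 d.+1 d.+2].
  move=> k ltk; have -> : p + 10 + len a + k = p + 5 + len a + (5 + k) by lia.
  by rewrite cQ //; move: k ltk; do 2![case=> //].
have q1 : q 1 = r 1 by rewrite qj.
eexists; split.
- apply: runs_trans run _.
  apply: (runs_step cL) => {}cL; apply: (runs_step cL) => _ /=.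
  rewrite !eqxx q1 qv subnn /=.
  apply: (runs_step cE) => {}cE; apply: (runs_step cE) => _ /=.
  rewrite (_ : (p + 10 + len a).+2 = p + (len a + 12)); last by lia.
  exact: runs_refl.
- by rewrite /= !dE qd.
- move=> j ltj; rewrite /= eqxx dE.
  case: eqP => [->|/eqP jv]; first by rewrite addn0 qd1.
  by rewrite !ltn_eqF ?qj //; lia.
Qed.

(** * Polynomial bounds on the running time *)

Definition poly_bounded (f : nat -> nat) : Prop :=
  exists c k, forall B, f B <= c * B.+1 ^ k.

Lemma poly_boundedC c : poly_bounded (fun=> c).
Proof. by exists c, 0 => B; rewrite muln1. Qed.

Lemma poly_boundedD f g :
  poly_bounded f -> poly_bounded g -> poly_bounded (fun B => f B + g B).
Proof.
move=> [c [k lef]] [c' [k' leg]]; exists (c + c'), (k + k') => B.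
rewrite mulnDl leq_add //.
  by apply: leq_trans (lef B) _; rewrite leq_mul2l leq_pexp2l ?leq_addr ?orbT.
by apply: leq_trans (leg B) _; rewrite leq_mul2l leq_pexp2l ?leq_addl ?orbT.
Qed.

Lemma poly_boundedM f : poly_bounded f -> poly_bounded (fun B => B * f B).
Proof.
move=> [c [k lef]]; exists c, k.+1 => B.
by rewrite expnS mulnCA leq_mul.
Qed.

Lemma cost_poly e : poly_bounded (cost^~ e).
Proof.
elim: e => /= [_|_|a IHa b IHb|a IHa b IHb|a IHa|a IHa b IHb|_ a IHa];
  do ?[apply: poly_boundedD | apply: poly_boundedM]; by [|apply: poly_boundedC].
Qed.

Lemma leq_cost e : {homo cost^~ e : B B' / B <= B'}.
Proof.
move=> B B' leB.
by elim: e => //= *; rewrite ?leq_add // leq_mul // leq_add.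
Qed.

(** For N > 0 one has N+1 <= 2N, which costs a factor 2^k; the additive constant covers N = 0. *)
Lemma poly_bounded_expn f : poly_bounded f ->
  exists c k, forall N, f N <= c * N ^ k + c.
Proof.
move=> [c [k lef]]; exists (c * 2 ^ k), k => N.
apply: leq_trans (lef N) _; rewrite -mulnA -mulnDr leq_mul2l.
apply/orP; right; case: N => [|N]; first by rewrite exp1n ltn_addl ?expn_gt0.
apply: leq_trans (leq_addr _ _); rewrite -expnMn.
by case: k {lef} => // k; rewrite leq_exp2r //; lia.
Qed.

Definition input_regs (N n : nat) : nat -> nat := nth 0 [:: N; n].

Section Machine.
Variables (K : nat) (s w : term).

(* The loop bound in register 1 is the input length N in the run of s, and    *)
(* the value of s in the run of w.                                            *)
Definition machine : program :=
  [:: IAdd 1 0 2] ++ code s K 1 ++ [:: IConst K.+1 0; IAdd 1 K K.+1] ++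
  code w K (3 + len s) ++ [:: IConst K.+1 0; IAdd 0 K K.+1].

(** Register 2 is initially 0, so the first instruction copies the input length into the loop bound.
    As n <= N and costs are monotone, the second phase is also bounded by a polynomial in N. *)
Lemma polytime_machine I (enc : I -> seq bool) (Q : I -> Prop) :
    2 < K -> regs_below K s -> regs_below K w ->
    (forall x, let N := size (enc x) in let m := fun i => nth false (enc x) i : nat in
       exists2 n, n <= N & sem s (input_regs N N) m = (n, m) /\
         ((sem w (input_regs N n) m).1 != 0 <-> Q x)) ->
  polytime_decidable enc Q.
Proof.
move=> K_gt2 sK wK semP.
have [c [k bound]] : exists c k, forall N,
    1 + (cost N s + (2 + (cost N w + 2))) <= c * N ^ k + c.
  apply/poly_bounded_expn/poly_boundedD; first exact: poly_boundedC.
  apply: poly_boundedD; first exact: cost_poly.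
  apply: poly_boundedD; first exact: poly_boundedC.
  apply: poly_boundedD; [exact: cost_poly | exact: poly_boundedC].
exists machine, c, k => x; move/(_ x): semP.
set N := size _; set m := (fun i => _) => -[n leN [sems semw]].
have c0 : code_at machine 0 [:: IAdd 1 0 2] by apply: (@code_at_self [::]).
have c1 : code_at machine 1 (code s K 1) by apply: (@code_at_self [:: _]).
have c2 : code_at machine (1 + len s) [:: IConst K.+1 0; IAdd 1 K K.+1].
  have := @code_at_self ([:: IAdd 1 0 2] ++ code s K 1)
    [:: IConst K.+1 0; IAdd 1 K K.+1]
    (code w K (3 + len s) ++ [:: IConst K.+1 0; IAdd 0 K K.+1]).
  by rewrite -!catA size_cat size_code.
have c3 : code_at machine (1 + len s).+2 (code w K (3 + len s)).
  have := @code_at_self ([:: IAdd 1 0 2] ++ code s K 1 ++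
    [:: IConst K.+1 0; IAdd 1 K K.+1]) (code w K (3 + len s))
    [:: IConst K.+1 0; IAdd 0 K K.+1].
  by rewrite -!catA !size_cat size_code /= addn2.
have c4 : code_at machine (3 + len s + len w) [:: IConst K.+1 0; IAdd 0 K K.+1].
  have := @code_at_self ([:: IAdd 1 0 2] ++ code s K 1 ++
    [:: IConst K.+1 0; IAdd 1 K K.+1] ++ code w K (3 + len s))
    [:: IConst K.+1 0; IAdd 0 K K.+1] [::].
  rewrite cats0 -!catA; set q := size _.
  by have -> : q = 3 + len s + len w by rewrite /q !size_cat /= !size_code; lia.
have K0 : ((0 == K) = false) * ((1 == K) = false) * ((K == K.+1) = false)
  * ((0 == K.+1) = false) * ((1 == K.+1) = false) by repeat split; lia.
pose r0 : nat -> nat := [eta [eta (fun=> 0) with 0 |-> N] with 1 |-> N].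
have r0E j : r0 j = input_regs N N j.
  by case: j => [|[|[|j]]] //; rewrite /r0 /input_regs /= nth_nil.
have [r1 [run1 r1K r1j]] := code_correct r0 m (ltnW K_gt2) sK c1.
rewrite (sem_ext _ (ltnW K_gt2) sK (fun j _ => r0E j)) sems /= in run1 r1K.
pose r2 : nat -> nat := [eta [eta r1 with K.+1 |-> 0] with 1 |-> n].
have r2E j : j < K -> r2 j = input_regs N n j.
  move=> ltj; case: j ltj => [|[|j]] ltj //.
    by rewrite /r2 /= r1j.
  by rewrite /r2 /= eqSS ltn_eqF ?r1j // 1?ltnW // r0E /input_regs /= !nth_nil.
have [r3 [run3 r3K r3j]] := code_correct r2 m (ltnW K_gt2) wK c3.
rewrite (sem_ext _ (ltnW K_gt2) wK r2E) in run3 r3K.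
set m' := (sem w _ _).2 in run3.
have {}run3 := runs_leq (leq_cost w leN) run3.
pose r4 : nat -> nat := [eta [eta r3 with K.+1 |-> 0] with 0 |-> r3 K].
have [t let_ runt] : runs machine (init (enc x))
    (Config (3 + len s + len w).+2 r4 m') (c * N ^ k + c).
  apply: runs_leq (bound N) _.
  apply: (runs_step c0) => _ /=; rewrite addn0.
  apply: runs_trans run1 _; rewrite add2n.
  apply: (runs_step c2) => {}c2; apply: (runs_step c2) => _ /=.
  rewrite K0 eqxx addn0 r1K; apply: runs_trans run3 _.
  apply: (runs_step c4) => {}c4; apply: (runs_step c4) => _ /=.
  rewrite K0 eqxx addn0; exact: runs_refl.
exists t => //; rewrite runt /halted /accepting /=; split; last by rewrite /r4 /= r3K.
by rewrite /machine !size_cat /= size_cat !size_code /=; lia.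
Qed.
End Machine.

(** * Induced paths and clique separators *)

Definition far (T : eqType) (e : rel T) : rel T := fun x y => (x != y) && ~~ e x y.

Section InducedPaths.
Variables (T : finType) (e : rel T).
Hypotheses (e_sym : symmetric e) (e_irr : irreflexive e).
Local Notation far := (far e).

Lemma far_sym : symmetric far.
Proof. by move=> x y; rewrite /far eq_sym e_sym. Qed.

(** A form of [induced_path] suited to induction along the path: [far x] on the vertices after y
    excludes both repetitions and chords at x. *)
Fixpoint ipath (x : T) (p : seq T) : bool :=
  if p is y :: q then [&& e x y, all (far x) q & ipath y q] else true.

Lemma ipath_path x p : ipath x p -> path e x p.
Proof. by elim: p x => //= y p IHp x /and3P[-> _ /IHp]. Qed.

Lemma ipathP x p : reflect (induced_path e x p) (ipath x p).
Proof.
have dflt a y q k : k < size (y :: q) -> nth a (y :: q) k = nth y (y :: q) k :> T.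
  by move=> ltk; apply: set_nth_default.
apply: (iffP idP).
  elim: p x => [|y p IHp] x /=; first by split=> //= -[|i] [|j].
  case/and3P=> exy farx /IHp[pp up chord].
  have xp : x \notin p by apply/negP => /(allP farx); rewrite /far eqxx.
  split; first by rewrite /= exy.
    rewrite cons_uniq up andbT inE negb_or xp andbT.
    by apply: contraTneq exy => ->; rewrite e_irr.
  move=> [|i] [|j] //= ltij ltj; last first.
    rewrite !(dflt x) ?chord //; apply: ltn_trans (ltnW ltij) ltj.
  case: j ltij ltj => // j _; rewrite /= !ltnS => ltj.
  by have /andP[] := allP farx _ (mem_nth x ltj).
elim: p x => [|y p IHp] x //= [/= /andP[exy pp] /andP[xp up] chord].
rewrite exy IHp /=; last first.
  split=> // i j ltij ltj.
  rewrite -!(dflt x) //; first exact: (chord i.+1 j.+1).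
  exact: ltn_trans (ltnW ltij) ltj.
rewrite andbT; apply/allP => z zp; rewrite /far.
have -> /= : x != z by apply: contraNneq xp => ->; rewrite inE zp orbT.
have := chord 0 (index z p).+2 isT; rewrite /= !ltnS index_mem nth_index //.
exact.
Qed.

Lemma m_convexP (S : {set T}) :
  (forall x p, ipath x p -> x \in S -> last x p \in S -> {subset p <= S}) ->
  m_convex e S.
Proof.
move=> convS x p /ipathP ip xS lS z; rewrite inE => /predU1P[-> //|].
exact: convS lS z.
Qed.

Lemma m_convex_ipath (S : {set T}) x p : m_convex e S -> ipath x p ->
  x \in S -> last x p \in S -> {subset p <= S}.
Proof.
by move=> convS /ipathP ip xS lS z zp; apply: (convS x p) => //; rewrite inE zp orbT.
Qed.

(** Shortcutting: given an induced path from the second vertex on, jump from x to its last vertex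
    that equals x or is adjacent to it. The start x itself need not satisfy [Q]. *)
Lemma ipath_exists (Q : pred T) x p : path [rel y z | e y z && Q z] x p ->
  exists q, [/\ ipath x q, last x q = last x p & all Q q].
Proof.
elim: p x => [|y p IHp] x /=; first by exists [::].
case/andP=> /andP[exy Qy] /IHp[q [iq <- Qq]].
have : has (predC (far x)) (y :: q) by rewrite /= /far exy andbF.
have : all Q (y :: q) by rewrite /= Qy.
elim: q y iq {p IHp exy Qy Qq} => [|z q IHq] y iq /andP[Qy Qq].
  rewrite /= orbF negb_and !negbK => /predU1P[->|exy]; first by exists [::].
  by exists [:: y]; rewrite /= exy Qy.
case: (boolP (has (predC (far x)) (z :: q))) => [hx _|nhx].
  by case/and3P: iq => _ _ iq; apply: IHq iq Qq hx.
rewrite -[has _ _]/(~~ far x y || has _ (z :: q)) (negPf nhx) orbF.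
rewrite negb_and !negbK => /predU1P[->|exy].
  by exists (z :: q); split=> //; case/and3P: iq.
move: nhx; rewrite has_predC negbK => farx.
by exists [:: y, z & q]; split=> //; [apply/and3P | rewrite -[all _ _]/(Q y && _) Qy].
Qed.

(** An induced path that leaves X right after x leaves the last outside vertex towards some z in X;
    then x and z are boundary vertices, and they are far because they are not consecutive on the
    path. *)
Lemma m_convex_clique_boundary (X : {set T}) :
    (forall a b a' b', a \in X -> b \in X -> a' \notin X -> b' \notin X ->
       e a a' -> e b b' -> ~~ far a b) ->
  m_convex e X.
Proof.
move=> bX; apply: m_convexP => x p.
elim: p x => [|y p IHp] x //= /and3P[exy farx ip] xX lX.
suff yX : y \in X by move=> z /predU1P[-> //|]; apply: IHp ip yX lX z.
apply/negPn/negP => yX.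
have [z zp [zX [z' z'X ezz']]] :
    exists2 z, z \in p & z \in X /\ exists2 z', z' \notin X & e z z'.
  move/ipath_path: ip lX yX; elim: p y {IHp farx exy} => [|z p IHp] y /=.
    by move=> _ ->.
  case/andP=> eyz pp lX yX; case: (boolP (z \in X)) => zX.
    by exists z; rewrite ?mem_head //; split=> //; exists y; rewrite // e_sym.
  by have [t tp tX] := IHp z pp lX zX; exists t; rewrite // inE tp orbT.
by case/negP: (bX _ _ _ _ xX zX yX z'X exy ezz'); apply: (allP farx).
Qed.

Lemma m_convex_clique (X : {set T}) : {in X &, forall a b, ~~ far a b} -> m_convex e X.
Proof. by move=> cX; apply: m_convex_clique_boundary => a b a' b' aX bX *; apply: cX. Qed.

(* The vertices of H adjacent to a component K of the complement of H form a  *)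
(* clique, which separates K from the other vertices.                         *)
Lemma m_convex_2cover_of_proper (H : {set T}) u v w :
  m_convex e H -> u \in H -> v \in H -> far u v -> w \notin H ->
  has_m_convex_2cover e.
Proof.
move=> convH uH vH faruv wH.
pose r := [rel x y | [&& e x y, x \notin H & y \notin H]].
have r_sym : connect_sym r.
  by apply: sym_connect_sym => x y /=; rewrite e_sym andbCA andbC -andbA andbC.
pose K := [set x | connect r w x].
have KH x : x \in K -> x \notin H.
  rewrite inE => /connectP[p]; case/lastP: p => [|p z]; first by move=> _ ->.
  by rewrite rcons_path last_rcons => /andP[_ /and3P[_ _ zH]] ->.
have KN x y : x \in K -> e x y -> y \notin H -> y \in K.
  move=> xK exy yH; move: (xK); rewrite !inE => wx.
  by apply: connect_trans wx (connect1 _); rewrite /= exy KH.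
pose C := [set c in H | [exists k in K, e c k]].
have C_clique a b : a \in C -> b \in C -> ~~ far a b.
  rewrite !inE => /andP[aH /exists_inP[k kK eak]] /andP[bH /exists_inP[k' kK' ebk']].
  apply/negP => farab.
  (* An induced path from a to b with all later vertices in K or equal to b stays in H by convexity.
     Since K avoids H, its first step already reaches b, contradicting [far a b]. *)
  pose Q := [pred x | (x \in K) || (x == b)].
  have [p pp lp] : exists2 p, path [rel y z | e y z && Q z] a p & last a p = b.
    have /connectP[p pp lp] : connect r k k'.
      by apply: (@connect_trans _ _ w); rewrite ?(r_sym k); [move: kK|move: kK']; rewrite inE.
    exists (k :: rcons p b); last by rewrite /= last_rcons.
    rewrite /= eak kK /= rcons_path -lp; apply/andP; split; last first.
      by rewrite /= e_sym ebk' eqxx orbT.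
    elim: p k kK {eak lp} pp => //= y p IHp k kK /andP[/and3P[eky _ yH] pp].
    have yK := KN _ _ kK eky yH.
    by rewrite eky yK IHp.
  have [q [iq lq Qq]] := ipath_exists pp.
  rewrite lp in lq.
  case: q iq lq Qq => [|y q] /= iq lq.
    by case/andP: farab; rewrite lq eqxx.
  case/andP=> Qy _.
  have yH : y \in H.
    apply: (m_convex_ipath convH (p := y :: q)) aH _ _ _ => //=; first by rewrite lq.
    by rewrite mem_head.
  case/orP: Qy => [/KH|/eqP yb]; first by rewrite yH.
  by case/and3P: iq => eay _ _; case/andP: farab => _; rewrite -yb eay.
exists (K :|: C), (~: K); split.
(* A neighbour of K outside K lies in H, hence in C; so the boundary of [K :|: C] is contained in
   the clique C. *)
- apply: m_convex_clique_boundary => a b a' b' aX bX a'X b'X eaa' ebb'.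
  have inC c c' : c \in K :|: C -> c' \notin K :|: C -> e c c' -> c \in C.
    case/setUP=> // cK; rewrite inE negb_or => /andP[c'K c'C] ecc'.
    case/negP: c'K; apply: (KN c) => //; apply: contra c'C => c'H.
    by rewrite inE c'H; apply/exists_inP; exists c; rewrite // e_sym.
  by apply: C_clique; [apply: inC eaa' | apply: inC ebb'].
- apply: m_convex_clique_boundary => a b a' b' aX bX a'X b'X eaa' ebb'.
  have inC c c' : c \in ~: K -> c' \notin ~: K -> e c c' -> c \in C.
    rewrite inE [c' \in _]inE negbK => cK c'K ecc'; rewrite inE.
    apply/andP; split; last by apply/exists_inP; exists c'.
    by apply: contraNT cK; apply: KN c'K _; rewrite e_sym.
  by apply: C_clique; [apply: inC eaa' | apply: inC ebb'].
(* If [K :|: C] were everything, u and v, which are in H and so not in K, would both lie in the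
   clique C. *)
- apply: contraTneq faruv => VT; apply: C_clique.
    by have := in_setT u; rewrite -VT inE => /orP[/KH|//]; rewrite uH.
  by have := in_setT v; rewrite -VT inE => /orP[/KH|//]; rewrite vH.
- apply/eqP => /setP/(_ w); rewrite !inE connect0; done.
- by rewrite setUAC setUCr setTU.
Qed.

End InducedPaths.

(** * The characterization by a least fixpoint *)

Section Derivation.
Variables (T : finType) (e : rel T).
Local Notation far := (far e).

(* Facts of kind 0: b and c are in the same component of the graph induced by *)
(* the vertices other than a and its neighbors; of kind 1: c is in the convex *)
(* hull of a and b; of kind 2: the complement of the graph has a walk of even *)
(* length from b to c (and a is ignored).                                     *)
Definition rule (R : nat -> T -> T -> T -> bool) (t : nat) (a b c : T) : bool :=
  match t with
  | 0 => (b == c) && far a b || [exists x, [&& R 0 a b x, e x c & far a c]]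
  | 1 => [|| c == a, c == b |
           [exists p, exists q, exists x,
             [&& R 1 a b p, R 1 a b q, R 0 p q x, e x c & e p c]]]
  | _ => (b == c) || [exists x, exists y, [&& R 2 a b x, far x y & far y c]]
  end.

Lemma rule_mono (R R' : nat -> T -> T -> T -> bool) t a b c :
    (forall t a b c, t < 3 -> R t a b c -> R' t a b c) ->
  rule R t a b c -> rule R' t a b c.
Proof.
move=> RR'; case: t => [|[|t]] /=.
- case: (_ && _) => //= /existsP[x /and3P[/RR' Rx exc fac]].
  by apply/existsP; exists x; rewrite Rx ?exc.
- case: (c == a) => //=; case: (c == b) => //=.
  case/existsP=> p /existsP[q /existsP[x /and5P[/RR' Rp /RR' Rq /RR' Rx exc epc]]].
  apply/existsP; exists p; apply/existsP; exists q; apply/existsP; exists x.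
  by rewrite Rp ?Rq ?Rx ?exc.
- case: (b == c) => //= /existsP[x /existsP[y /and3P[/RR' Rx fxy fyc]]].
  by apply/existsP; exists x; apply/existsP; exists y; rewrite Rx ?fxy.
Qed.

Definition tab (S : {set 'I_3 * T * T * T}) (t : nat) (a b c : T) : bool :=
  (inord t, a, b, c) \in S.

Definition derive (S : {set 'I_3 * T * T * T}) : {set 'I_3 * T * T * T} :=
  [set f : 'I_3 * T * T * T | rule (tab S) f.1.1.1 f.1.1.2 f.1.2 f.2].

Definition derivable : nat -> T -> T -> T -> bool := tab (fixset derive).

Lemma tab_derive S t a b c : t < 3 -> tab (derive S) t a b c = rule (tab S) t a b c.
Proof. by move=> ltt; rewrite /tab inE /= inordK. Qed.

Lemma derive_mono : {homo derive : S S' / S \subset S'}.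
Proof.
move=> S S' /subsetP SS'; apply/subsetP => f; rewrite !inE.
by apply: rule_mono => t a b c _; apply: SS'.
Qed.

Lemma derivableE t a b c : t < 3 -> derivable t a b c = rule derivable t a b c.
Proof. by move=> ltt; rewrite {1}/derivable -(fixsetK derive_mono) tab_derive. Qed.

(** Induction on the stages of the fixpoint iteration, with [R] the preceding stage. *)
Lemma derivable_ind (P : nat -> T -> T -> T -> Prop) :
    (forall R : nat -> T -> T -> T -> bool,
       (forall t a b c, t < 3 -> R t a b c -> P t a b c) ->
       forall t a b c, t < 3 -> rule R t a b c -> P t a b c) ->
  forall t a b c, t < 3 -> derivable t a b c -> P t a b c.
Proof.
move=> PR; rewrite /derivable /fixset; elim: #|_| => [|k IHk] t a b c ltt.
  by rewrite /tab inE.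
by rewrite [iter _ _ _]/= tab_derive //; apply: PR ltt.
Qed.

Hypotheses (e_sym : symmetric e) (e_irr : irreflexive e).

(** For kind 1, the path c, x, ..., q stays far from p after c; an induced path extracted from it,
    with p put in front, is an induced path from p to q through c. For kind 2, f is a proper
    2-colouring of the complement, and even walks preserve colours. *)
Lemma derivable_sound t a b c : t < 3 -> derivable t a b c ->
  match t with
  | 0 => [/\ far a b, far a c &
             connect [rel x y | [&& e x y, far a x & far a y]] b c]
  | 1 => forall S, m_convex e S -> a \in S -> b \in S -> c \in S
  | _ => forall f : T -> bool, (forall x y, far x y -> f x != f y) -> f b = f c
  end.
Proof.
move: t a b c; apply: derivable_ind => R IH [|[|[|t]]] a b c // _ /=.
- case/orP=> [/andP[/eqP<- fab]|/existsP[x /and3P[/IH[]// fab fax bx exc fac]]].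
    by rewrite connect0.
  by split=> //; apply: connect_trans bx (connect1 _); rewrite /= exc fax.
- case/or3P=> [/eqP->|/eqP->|] //.
  case/existsP=> p /existsP[q /existsP[x /and5P[Rp Rq Rx exc epc]]] S convS aS bS.
  have pS : p \in S by apply: (IH 1 _ _ _ _ Rp).
  have qS : q \in S by apply: (IH 1 _ _ _ _ Rq).
  have [fpq fpx qx] := IH 0 _ _ _ isT Rx.
  have /connectP[s ps ls] :
      connect [rel x y | [&& e x y, far p x & far p y]] x q.
    rewrite sym_connect_sym // => y z /=; rewrite e_sym.
    by case: (far p y); rewrite ?andbF ?andbT.
  have [|s' [ic ls' fs]] := @ipath_exists _ e (far p) c (x :: s).
    rewrite /= e_sym exc fpx /=; apply: sub_path ps => y z /=.
    by case/and3P=> -> _ ->.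
  have ip : ipath e p (c :: s') by rewrite /= epc fs.
  apply: (m_convex_ipath e_irr convS ip) => //; last exact: mem_head.
  by rewrite /= ls' /= -ls.
- case/predU1P=> [-> //|/existsP[x /existsP[y /and3P[Rx fxy fyc]]]] f fP.
  rewrite (IH 2 _ _ _ isT Rx f fP).
  by move: (fP _ _ fxy) (fP _ _ fyc); case: (f x); case: (f y); case: (f c).
Qed.

(** On an induced path x, y, z, ..., l with ends in the hull, z and l are joined by vertices far
    from x, and y is a common neighbour of x and z; hence y is derivable, and the argument repeats
    from y. *)
Lemma hull_convex u v : m_convex e [set x | derivable 1 u v x].
Proof.
apply: m_convexP => // x p.
elim: p x => [|y p IHp] x //= /and3P[exy farx ip] xX lX.
suff yX : y \in [set x | derivable 1 u v x].
  by move=> z /predU1P[-> //|]; apply: IHp ip yX lX z.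
case: p farx ip lX {IHp} => [|z p] // farx /and3P[eyz _ ip] lX.
rewrite inE derivableE //=; apply/or3P/Or33.
apply/existsP; exists x; apply/existsP; exists (last z p); apply/existsP; exists z.
move: xX lX; rewrite !inE /= => -> ->; rewrite [e z y]e_sym eyz exy !andbT /=.
move/ipath_path: ip => {eyz}.
elim: p z farx => [|t p IHp] z /= /andP[fxz farx].
  by rewrite derivableE //= eqxx fxz.
case/andP=> ezt pp; rewrite derivableE //=; apply/orP; right.
by apply/existsP; exists t; rewrite IHp // e_sym ezt.
Qed.

Lemma derivable2_connect a b c :
  connect [rel x z | [exists y, far x y && far y z]] b c -> derivable 2 a b c.
Proof.
case/connectP=> p pp ->{c}.
elim/last_ind: p pp => [|p z IHp]; first by rewrite derivableE //= eqxx.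
rewrite rcons_path last_rcons => /andP[/IHp bl /existsP[y /andP[fy fyz]]].
rewrite derivableE //=; apply/orP; right.
by apply/existsP; exists (last b p); apply/existsP; exists y; rewrite bl fy.
Qed.

(** Without an odd closed walk in the complement, the vertices at even walk distance from the root
    of their complement component, and the remaining ones, form two cliques. *)
Lemma m_convex_2cover_of_bipartite : 1 < #|T| ->
  (forall u v, far u v -> ~~ derivable 2 u u v) -> has_m_convex_2cover e.
Proof.
case/card_gt1P=> x0 [x1 [_ _ x01]] nodd.
have far_symm := far_sym e_sym.
pose r := [rel x z | [exists y, far x y && far y z]].
have r_sym : connect_sym r.
  apply: sym_connect_sym => x y /=; apply/existsP/existsP => -[z /andP[fxz fzy]];
  by exists z; rewrite far_symm fzy far_symm fxz.
have f_sym : connect_sym far by apply: sym_connect_sym.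
have no_odd u v : far u v -> ~~ connect r u v.
  by move=> /nodd; apply: contra; apply: derivable2_connect.
pose V := [set v | connect r (root far v) v].
(* In a complete graph every set is m-convex, and two distinct vertices suffice; otherwise a far
   pair shows that neither clique is everything. *)
have [/existsP[u /existsP[v fuv]]|nofar] := boolP [exists u, exists v, far u v]; last first.
  have cl (X : {set T}) : m_convex e X.
    apply: m_convex_clique => // a b _ _; apply: contra nofar => fab.
    by apply/existsP; exists a; apply/existsP; exists b.
  exists [set x0], (~: [set x0]); split; rewrite ?setUCr //.
    by apply/eqP => /setP/(_ x1); rewrite !inE eq_sym (negPf x01).
  by apply/eqP => /setP/(_ x0); rewrite !inE eqxx.
have rootE a b : far a b -> root far a = root far b.
  by move=> fab; apply/(rootP f_sym)/connect1.
have clV a b : a \in V -> b \in V -> ~~ far a b.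
  rewrite !inE => ra rb; apply/negP => fab; case/negP: (no_odd _ _ fab).
  by rewrite r_sym in ra; apply: connect_trans ra _; rewrite (rootE _ _ fab).
(* Every walk of the complement is even, or becomes so when its end is replaced by a vertex far from
   that end. *)
have reach z0 p : path far z0 p ->
    connect r z0 (last z0 p) \/
      exists2 x, far x (last z0 p) & connect r z0 x.
  elim/last_ind: p => [_|p z IHp]; first by left; apply: connect0.
  rewrite rcons_path last_rcons => /andP[/IHp[rl|[x fxl rx]] flz]; [right|left].
    by exists (last z0 p).
  apply: connect_trans rx (connect1 _); apply/existsP.
  by exists (last z0 p); rewrite fxl.
have clW a b : a \in ~: V -> b \in ~: V -> ~~ far a b.
  rewrite !inE => ra rb; apply/negP => fab.
  have := connect_root far a; rewrite f_sym => /connectP[p pp lp].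
  have := reach _ _ pp; rewrite -lp.
  case=> [ra'|[x fxa rx]]; first by rewrite ra' in ra.
  case/negP: rb; rewrite -(rootE _ _ fab); apply: connect_trans rx (connect1 _).
  by apply/existsP; exists a; rewrite fxa.
exists V, (~: V); split; rewrite ?setUCr //.
- exact: m_convex_clique.
- exact: m_convex_clique.
- by apply: contraTneq fuv => VT; apply: clV; rewrite VT inE.
- by apply: contraTneq fuv => VT; apply: clW; rewrite VT inE.
Qed.

Theorem has_m_convex_2coverP :
  has_m_convex_2cover e <->
  (exists u v w, far u v && ~~ derivable 1 u v w) \/
  (1 < #|T| /\ forall u v, far u v -> ~~ derivable 2 u u v).
Proof.
split=> [[V1 [V2 [c1 c2 n1 n2 V12]]]|]; last first.
  case=> [[u [v [w /andP[fuv nw]]]]|[]]; last exact: m_convex_2cover_of_bipartite.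
  have convH := @hull_convex u v.
  apply: (m_convex_2cover_of_proper e_sym e_irr convH _ _ fuv (w := w)).
  - by rewrite inE derivableE //= eqxx.
  - by rewrite inE derivableE //= eqxx orbT.
  - by rewrite inE.
have properP (V : {set T}) : m_convex e V -> V != setT ->
    (exists u v w, far u v && ~~ derivable 1 u v w) \/ {in V &, forall u v, ~~ far u v}.
  move=> cV; rewrite -subTset => /subsetPn[w _ wV].
  have [/exists_inP[u uV /exists_inP[v vV fuv]]|nofar] :=
      boolP [exists u in V, exists v in V, far u v].
    left; exists u, v, w; rewrite fuv; apply: contra wV.
    by move/(@derivable_sound 1 _ _ _ isT); apply.
  right=> u v uV vV; apply: contra nofar => fuv.
  by apply/exists_inP; exists u => //; apply/exists_inP; exists v.
have [|cl1] := properP _ c1 n1; first by left.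
have [|cl2] := properP _ c2 n2; first by left.
have V1N x : x \notin V1 -> x \in V2.
  by have := in_setT x; rewrite -V12 inE => /orP[->|].
right; split.
  move: n1 n2; rewrite -!subTset => /subsetPn[x _ xV] /subsetPn[y _ yV].
  apply/card_gt1P; exists x, y; split=> //.
  by apply: contraNneq yV => <-; apply: V1N.
move=> u v fuv; apply/negP => /(@derivable_sound 2 _ _ _ isT)/(_ (mem V1)) /=.
have fP x y : far x y -> (x \in V1) != (y \in V1).
  move=> fxy; case: (boolP (x \in V1)) => xV; case: (boolP (y \in V1)) => yV //.
    by case/negP: (cl1 _ _ xV yV).
  by case/negP: (cl2 _ _ (V1N _ xV) (V1N _ yV)).
by move/(_ fP) => uv; have := fP _ _ fuv; rewrite uv eqxx.
Qed.

End Derivation.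

(** * The algorithm *)

Fixpoint pure (e : term) : bool :=
  match e with
  | Var _ | Cst _ => true
  | Add a b | Sub a b => pure a && pure b
  | Get a | Sum _ a => pure a
  | Inc _ _ => false
  end.

Fixpoint val (e : term) (r m : nat -> nat) : nat :=
  match e with
  | Var x => r x
  | Cst c => c
  | Add a b => val a r m + val b r m
  | Sub a b => val a r m - val b r m
  | Get a => m (val a r m)
  | Inc _ _ => 0
  | Sum v a => \sum_(i < r 1) val a [eta r with v.+2 |-> nat_of_ord i] m
  end.

Lemma sem_pure e r m : pure e -> sem e r m = (val e r m, m).
Proof.
elim: e r m => //= [a IHa b IHb|a IHa b IHb|a IHa|v a IHa] r m.
- by case/andP=> pa pb; rewrite !(IHa, IHb).
- by case/andP=> pa pb; rewrite !(IHa, IHb).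
- by move=> pa; rewrite IHa.
move=> pa; elim: (r 1) => [|k IHk] /=; first by rewrite big_ord0.
by rewrite IHk big_ord_recr IHa.
Qed.

Lemma sem_Inc a b r m : pure a -> pure b -> sem (Inc a b) r m =
  (0, [eta m with val a r m |-> val b r m + m (val a r m)] : nat -> nat).
Proof. by move=> pa pb; rewrite /= !sem_pure. Qed.

(** Memory is changed only by additions, so a fact once marked stays marked. *)
Lemma leq_sem e r m x : m x <= (sem e r m).2 x.
Proof.
elim: e r m => //= [a IHa b IHb|a IHa b IHb|a IHa b IHb|v a IHa] r m.
- exact: leq_trans (IHa r m) (IHb _ _).
- exact: leq_trans (IHa r m) (IHb _ _).
- apply: leq_trans (IHa r m) _; apply: leq_trans (IHb r _) _.
  by case: eqP => [->|//]; apply: leq_addl.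
elim: (r 1) => //= k; move/leq_trans; apply; exact: IHa.
Qed.

Lemma sem_Sum_ind (P : nat -> nat * (nat -> nat) -> Prop) v a r m :
    P 0 (0, m) ->
    (forall i s, i < r 1 -> P i s ->
       let t := sem a [eta r with v.+2 |-> i] s.2 in P i.+1 (s.1 + t.1, t.2)) ->
  P (r 1) (sem (Sum v a) r m).
Proof.
move=> P0 PS /=; elim: {-2}(r 1) (leqnn (r 1)) => //= k IHk ltk.
by apply: PS => //; apply/IHk/ltnW.
Qed.

(** Loop rule: I is an invariant, and D i is what round i achieves; monotonicity in the memory keeps
    it true in later rounds. *)
Lemma sem_for (I : (nat -> nat) -> Prop) (D : nat -> (nat -> nat) -> Prop) v a r m :
    (forall i m m', (forall x, m x <= m' x) -> D i m -> D i m') -> I m ->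
    (forall i m, i < r 1 -> I m -> let s := sem a [eta r with v.+2 |-> i] m in
       [/\ s.1 = 0, I s.2 & D i s.2]) ->
  let s := sem (Sum v a) r m in [/\ s.1 = 0, I s.2 & forall i, i < r 1 -> D i s.2].
Proof.
move=> Dmono Im body.
pose P k (s : nat * (nat -> nat)) := [/\ s.1 = 0, I s.2 & forall i, i < k -> D i s.2].
apply: (@sem_Sum_ind P) => // i s lti [s0 Is Ds] t.
have [t0 It Dt] := body i s.2 lti Is.
split=> //=; first by rewrite s0 t0.
move=> j; rewrite ltnS leq_eqVlt => /predU1P[-> //|/Ds].
by apply: Dmono => x; apply: leq_sem.
Qed.

Lemma sem_repeat (P : nat -> (nat -> nat) -> Prop) d k v a r m :
    P k m ->
    (forall i l m', P l m' -> let s := sem a [eta r with v.+2 |-> i] m' in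
       s.1 = 0 /\ P (l + d) s.2) ->
  let s := sem (Sum v a) r m in s.1 = 0 /\ P (k + r 1 * d) s.2.
Proof.
move=> Pk body.
pose Q i (s : nat * (nat -> nat)) := s.1 = 0 /\ P (k + i * d) s.2.
apply: (@sem_Sum_ind Q) => [|i s lti [s0 Ps] t]; first by rewrite /Q addn0.
have [t0 Pt] := body i _ _ Ps.
by split; rewrite /= ?s0 ?t0 // mulSn [d + _]addnC addnA.
Qed.

(** * Formulas as terms *)

Definition Not a := Sub (Cst 1) a.
Definition Or a b := Add a b.
Definition And a b := Not (Or (Not a) (Not b)).
Definition Eq x y := Not (Or (Sub (Var x) (Var y)) (Sub (Var y) (Var x))).
(* In contrast to Sum, the bound register is x itself, for x > 1. *)
Definition Ex x a := Sum x.-2 a.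
Definition All x a := Not (Ex x (Not a)).

(** Truth is being nonzero: addition is then disjunction, a sum is an existential quantifier, and
    truncated subtraction from 1 is negation. *)
Definition holds e r m := val e r m != 0.

Lemma holds_Not a r m : holds (Not a) r m = ~~ holds a r m.
Proof. by rewrite /holds /=; case: (val a r m) => [|[]]. Qed.

Lemma holds_Or a b r m : holds (Or a b) r m = holds a r m || holds b r m.
Proof. by rewrite /holds /= addn_eq0 negb_and. Qed.

Lemma holds_And a b r m : holds (And a b) r m = holds a r m && holds b r m.
Proof. by rewrite holds_Not holds_Or !holds_Not negb_or !negbK. Qed.

Lemma val_Not a r m : val (Not a) r m = ~~ holds a r m.
Proof. by rewrite /holds /=; case: (val a r m) => [|[]]. Qed.

Lemma holds_Eq x y r m : holds (Eq x y) r m = (r x == r y).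
Proof. by rewrite holds_Not holds_Or /holds /=; apply/idP/idP; lia. Qed.

Lemma holds_Sub a b r m : holds (Sub a b) r m = (val b r m < val a r m).
Proof. by rewrite /holds /= -lt0n subn_gt0. Qed.

Lemma val_Ex x a r m :
  val (Ex x a) r m = \sum_(i < r 1) val a [eta r with x.-2.+2 |-> nat_of_ord i] m.
Proof. by []. Qed.

Lemma holds_Ex x a r m (n : nat) : r 1 = n ->
  holds (Ex x a) r m =
  [exists i : 'I_n, holds a [eta r with x.-2.+2 |-> nat_of_ord i] m].
Proof.
move=> <-; rewrite /holds val_Ex sum_nat_eq0 negb_forall.
by apply: eq_existsb => i; rewrite implyTb.
Qed.

Lemma holds_All x a r m (n : nat) : r 1 = n ->
  holds (All x a) r m =
  [forall i : 'I_n, holds a [eta r with x.-2.+2 |-> nat_of_ord i] m].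
Proof.
move=> r1; rewrite holds_Not (holds_Ex _ _ _ r1) negb_exists.
by apply: eq_forallb => i; rewrite holds_Not negbK.
Qed.

(* Register 2 is not used for anything but such discarded loop variables. *)
Definition Scale a := Sum 0 a.

Definition addr (n t a b c : nat) : nat := ((t * n + a) * n + b) * n + c.

Definition Addr t a b c :=
  Add (Scale (Add (Scale (Add (Scale (Cst t)) (Var a))) (Var b))) (Var c).

Lemma val_Addr t a b c r m : 2 < a -> 2 < b ->
  val (Addr t a b c) r m = addr (r 1) t (r a) (r b) (r c).
Proof.
move=> a2 b2 /=; rewrite (gtn_eqF a2) (gtn_eqF b2).
by rewrite !(sum_nat_const, card_ord) /addr; lia.
Qed.

(** Uniqueness of digits in base n, with an unbounded leading digit; marking one fact thus never
    touches another. *)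
Lemma addr_inj n t a b c t' a' b' c' :
    a < n -> b < n -> c < n -> a' < n -> b' < n -> c' < n ->
  addr n t a b c = addr n t' a' b' c' -> [/\ t = t', a = a', b = b' & c = c'].
Proof.
have step x y x' y' : y < n -> y' < n -> x * n + y = x' * n + y' -> x = x' /\ y = y'.
  move=> lty lty' eqxy; have n0 : 0 < n by apply: leq_ltn_trans lty.
  have := congr1 (divn^~ n) eqxy; rewrite !divnMDl // !divn_small // !addn0 => xx'.
  by move: eqxy; rewrite xx' => /addnI.
move=> an bn cn an' bn' cn'.
by case/step=> // /step[] // /step[] // -> -> -> ->.
Qed.

Definition Adj x y := Get (Add (Scale (Var x)) (Var y)).
(* Kind 0 is the adjacency matrix, at the addresses addr n 0 0 i j. *)
Definition Fact t a b c := Get (Addr t.+1 a b c).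
Definition Far x y := And (Not (Eq x y)) (Not (Adj x y)).

(* The fact to be derived has its vertices in the registers 3, 4 and 5. *)
Definition Rule (t : nat) : term :=
  match t with
  | 0 => Or (And (Eq 4 5) (Far 3 4))
            (Ex 8 (And (Fact 0 3 4 8) (And (Adj 8 5) (Far 3 5))))
  | 1 => Or (Eq 5 3) (Or (Eq 5 4) (Ex 6 (Ex 7 (Ex 8
           (And (Fact 1 3 4 6) (And (Fact 1 3 4 7) (And (Fact 0 6 7 8)
           (And (Adj 8 5) (Adj 6 5)))))))))
  | _ => Or (Eq 4 5) (Ex 8 (Ex 9
           (And (Fact 2 3 4 8) (And (Far 8 9) (Far 9 5)))))
  end.

(** The double negation turns the truth value of the rule into 0 or 1. *)
Definition Mark t := Inc (Addr t.+1 3 4 5) (Not (Not (Rule t))).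
Definition Round := Ex 3 (Ex 4 (Ex 5 (Add (Mark 0) (Add (Mark 1) (Mark 2))))).
(** Three rounds repeated n^3 times: 3n^3 is the number of facts, hence of iterations taken by
    [fixset]. *)
Definition Saturate := Ex 2 (Ex 2 (Ex 2 (Add Round (Add Round Round)))).

Definition Test :=
  Or (Ex 3 (Ex 4 (Ex 5 (And (Far 3 4) (Not (Fact 1 3 4 5))))))
     (And (Sub (Var 1) (Cst 1))
          (All 3 (All 4 (Or (Not (Far 3 4)) (Not (Fact 2 3 3 4)))))).

(** * Correctness of the saturation and of the final test *)

Section Correctness.
Variables (n : nat) (e : rel 'I_n).

Definition fact_at (m : nat -> nat) (t : nat) (a b c : 'I_n) : bool :=
  m (addr n t.+1 a b c) != 0.

Definition stores_adj (m : nat -> nat) : Prop :=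
  forall i j : 'I_n, m (i * n + j) = e i j.

Section Evaluation.
Variables (r m : nat -> nat).
Hypotheses (r1 : r 1 = n) (m_adj : stores_adj m).

Lemma holds_Adj x y (i j : 'I_n) : x != 2 -> r x = i -> r y = j ->
  holds (Adj x y) r m = e i j.
Proof.
move=> /negPf x2 rx ry; rewrite /holds /= x2 sum_nat_const card_ord r1 rx ry mulnC.
by rewrite m_adj; case: (e i j).
Qed.

Lemma holds_Far x y (i j : 'I_n) : x != 2 -> r x = i -> r y = j ->
  holds (Far x y) r m = far e i j.
Proof.
move=> x2 rx ry; by rewrite holds_And holds_Not holds_Eq holds_Not (holds_Adj x2 rx ry) rx ry.
Qed.

Lemma holds_Fact t x y z (a b c : 'I_n) : 2 < x -> 2 < y ->
  r x = a -> r y = b -> r z = c -> holds (Fact t x y z) r m = fact_at m t a b c.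
Proof.
move=> x2 y2 rx ry rz; rewrite /holds.
rewrite -[val _ _ _]/(m (val (Addr t.+1 x y z) r m)).
by rewrite val_Addr // r1 rx ry rz.
Qed.

End Evaluation.

Lemma holds_Rule r m t (a b c : 'I_n) : r 1 = n -> stores_adj m ->
    r 3 = a -> r 4 = b -> r 5 = c ->
  holds (Rule t) r m = rule e (fact_at m) t a b c.
Proof.
move=> r1 mA r3 r4 r5; case: t => [|[|t]]; rewrite [Rule _]/=.
- rewrite holds_Or holds_And holds_Eq r4 r5 (holds_Far r1 mA (i := a) (j := b)) //.
  congr (_ || _); rewrite (holds_Ex _ _ _ r1); apply: eq_existsb => x.
  rewrite 2!holds_And (holds_Fact _ _ _ (a := a) (b := b) (c := x)) //.
  by rewrite (holds_Adj _ mA (i := x) (j := c)) // (holds_Far _ mA (i := a) (j := c)).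
- rewrite holds_Or holds_Eq holds_Or holds_Eq r3 r4 r5.
  congr [|| _, _ | _]; rewrite (holds_Ex _ _ _ r1); apply: eq_existsb => p.
  rewrite (@holds_Ex _ _ _ _ n) //; apply: eq_existsb => q.
  rewrite (@holds_Ex _ _ _ _ n) //; apply: eq_existsb => x.
  rewrite 4!holds_And (holds_Fact _ _ _ (a := a) (b := b) (c := p)) //.
  rewrite (holds_Fact _ _ _ (a := a) (b := b) (c := q)) //.
  rewrite (holds_Fact _ _ _ (a := p) (b := q) (c := x)) //.
  rewrite (holds_Adj _ mA (x := 8) (i := x) (j := c)) //.
  by rewrite (holds_Adj _ mA (x := 6) (i := p) (j := c)).
rewrite holds_Or holds_Eq r4 r5.
congr (_ || _); rewrite (holds_Ex _ _ _ r1); apply: eq_existsb => x.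
rewrite (@holds_Ex _ _ _ _ n) //; apply: eq_existsb => y.
rewrite 2!holds_And (holds_Fact _ _ _ (a := a) (b := b) (c := x)) //.
by rewrite (holds_Far _ mA (i := x) (j := y)) // (holds_Far _ mA (i := y) (j := c)).
Qed.

(** Since rules are applied in place, a round may already use facts found in the same round. The
    marked facts are therefore only known to lie between a stage of the iteration and the
    fixpoint. *)
Definition sandwiched (R : nat -> 'I_n -> 'I_n -> 'I_n -> bool) (m : nat -> nat) :=
  [/\ stores_adj m,
      forall t a b c, t < 3 -> fact_at m t a b c -> derivable e t a b c &
      forall t a b c, t < 3 -> R t a b c -> fact_at m t a b c].

Lemma fact_at_leq m m' t a b c :
  (forall x, m x <= m' x) -> fact_at m t a b c -> fact_at m' t a b c.
Proof. by move=> lem; rewrite /fact_at -!lt0n => /leq_trans; apply. Qed.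

Lemma sem_Mark R r m t (a b c : 'I_n) : t < 3 -> r 1 = n ->
    r 3 = a -> r 4 = b -> r 5 = c -> sandwiched R m ->
  let s := sem (Mark t) r m in
  [/\ s.1 = 0, sandwiched R s.2 & rule e R t a b c -> fact_at s.2 t a b c].
Proof.
move=> ltt r1 r3 r4 r5 [mA mL mR] s.
pose A := addr n t.+1 a b c.
have sE : s = (0, [eta m with A |-> rule e (fact_at m) t a b c + m A] : nat -> nat).
  have pR : pure (Not (Not (Rule t))) by case: (t) => [|[|]].
  rewrite /s [LHS]sem_Inc //.
  rewrite val_Addr // r1 r3 r4 r5 -/A val_Not holds_Not negbK.
  by rewrite (holds_Rule t r1 mA r3 r4 r5).
have les x : m x <= s.2 x by apply: leq_sem.
have newE : fact_at s.2 t a b c = rule e (fact_at m) t a b c || fact_at m t a b c.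
  by rewrite sE /fact_at /= -/A eqxx addn_eq0 negb_and; case: rule.
have mLa : rule e (fact_at m) t a b c -> derivable e t a b c.
  by move=> ra; rewrite derivableE //; apply: rule_mono ra; apply: mL.
rewrite {1}sE; split=> //; last first.
  by move=> ra; rewrite newE (rule_mono _ ra).
split; last by move=> t' a' b' c' lt' /mR -/(_ lt'); apply: fact_at_leq.
  (* The adjacency matrix survives: its addresses have leading digit 0, while the marked cell has
     leading digit t+1. *)
  move=> i j; have n0 : 0 < n by apply: leq_ltn_trans (ltn_ord i).
  rewrite sE /= -mA; case: eqP => // ijA.
  have [] // : [/\ 0 = t.+1, 0 = a, i = b :> nat & j = c :> nat].
  by apply: (@addr_inj n); rewrite ?ltn_ord // -/A -ijA /addr mul0n.
move=> t' a' b' c' lt'; case: (eqVneq (addr n t'.+1 a' b' c') A) => [eqA|neA].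
  have [] := addr_inj (ltn_ord _) (ltn_ord _) (ltn_ord _) (ltn_ord _)
    (ltn_ord _) (ltn_ord _) eqA.
  case=> -> /val_inj-> /val_inj-> /val_inj->; rewrite newE.
  by case/orP=> [|/mL]; auto.
by rewrite /fact_at sE /= (negPf neA); apply: mL.
Qed.

Lemma sem_Add_zero a b r m : (sem a r m).1 = 0 ->
  (sem (Add a b) r m).1 = (sem b r (sem a r m).2).1.
Proof. by move=> /= ->. Qed.

Lemma cells_Add a b r m : (sem (Add a b) r m).2 = (sem b r (sem a r m).2).2.
Proof. by []. Qed.

Lemma sem_Round k r m : r 1 = n -> sandwiched (tab (iter k (derive e) set0)) m ->
  let s := sem Round r m in
  s.1 = 0 /\ sandwiched (tab (iter k.+1 (derive e) set0)) s.2.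
Proof.
move=> r1; set R := tab _ => mR.
(* The achievement of the innermost body for a triple: all three kinds of facts that follow from
   stage R are marked. *)
pose D a b c m := forall t (a' b' c' : 'I_n), t < 3 -> a' = a :> nat ->
  b' = b :> nat -> c' = c :> nat -> rule e R t a' b' c' -> fact_at m t a' b' c'.
have Dmono a b c m1 m2 : (forall x, m1 x <= m2 x) -> D a b c m1 -> D a b c m2.
  by move=> lem Dm t a' b' c' *; apply: (fact_at_leq lem); apply: Dm.
have [s0 [mA mL _] Ds] : let s := sem Round r m in [/\ s.1 = 0, sandwiched R s.2 &
    forall a, a < r 1 -> forall b, b < r 1 -> forall c, c < r 1 -> D a b c s.2].
  apply: (@sem_for (sandwiched R) (fun a m =>
      forall b, b < r 1 -> forall c, c < r 1 -> D a b c m))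
    => // [a m1 m2 lem Dm b ltb c ltc|a {mR}m lta mR].
    by apply: Dmono lem _; apply: Dm.
  apply: (@sem_for (sandwiched R) (fun b m => forall c, c < r 1 -> D a b c m))
    => // [b m1 m2 lem Dm c ltc|b {mR}m ltb mR].
    by apply: Dmono lem _; apply: Dm.
  apply: (@sem_for (sandwiched R) (fun c m => D a b c m))
    => // [c m1 m2|c {mR}m ltc mR]; first exact: Dmono.
  have {}lta : a < n by rewrite -r1.
  have {}ltb : b < n by rewrite -r1.
  have {}ltc : c < n by rewrite -r1.
  pose r' : nat -> nat := [eta [eta [eta r with 3 |-> a] with 4 |-> b] with 5 |-> c].
  rewrite -[X in sem _ X]/r'.
  have markE t m' (ltt : t < 3) := @sem_Mark R r' m' t (Ordinal lta) (Ordinal ltb) (Ordinal ltc)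
    ltt r1 erefl erefl erefl.
  have [z0 m0R f0] := markE 0 _ isT mR.
  have [z1 m1R f1] := markE 1 _ isT m0R.
  have [z2 m2R f2] := markE 2 _ isT m1R.
  move=> s; rewrite {}/s !sem_Add_zero // !cells_Add.
  split=> // t a' b' c' ltt ea eb ec.
  have -> : a' = Ordinal lta by apply: val_inj.
  have -> : b' = Ordinal ltb by apply: val_inj.
  have -> : c' = Ordinal ltc by apply: val_inj.
  case: t ltt => [|[|[|t]]] // _ Rt.
  - apply: fact_at_leq (f0 Rt) => x; rewrite -cells_Add; exact: leq_sem.
  - by apply: fact_at_leq (f1 Rt) => x; exact: leq_sem.
split=> //; split=> // t a b c ltt; rewrite [iter _ _ _]/= tab_derive //.
by apply: (Ds a _ b _ c _ t); rewrite ?r1.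
Qed.

(** After 3n^3 rounds the lower bound of the sandwich is the fixpoint itself and meets the upper
    bound. *)
Lemma sem_Saturate r m : r 1 = n -> stores_adj m ->
    (forall t a b c, t < 3 -> ~~ fact_at m t a b c) ->
  let s := sem Saturate r m in [/\ s.1 = 0, stores_adj s.2 &
    forall t a b c, t < 3 -> fact_at s.2 t a b c = derivable e t a b c].
Proof.
move=> r1 mA m0 s.
pose P k := sandwiched (tab (iter k (derive e) set0)).
have P0 : P 0 m.
  split=> // t a b c ltt; last by rewrite /tab inE.
  by rewrite (negPf (m0 _ _ _ _ ltt)).
have three r' k m' : r' 1 = n -> P k m' ->
    let s := sem (Add Round (Add Round Round)) r' m' in s.1 = 0 /\ P (k + 3) s.2.
  move=> r'1 mP; have [z1 mP1] := sem_Round r'1 mP.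
  have [z2 mP2] := sem_Round r'1 mP1; have [z3 mP3] := sem_Round r'1 mP2.
  by rewrite addn3; split; rewrite ?sem_Add_zero.
have [s0 [sA sL sR]] : s.1 = 0 /\ P (0 + r 1 * (r 1 * (r 1 * 3))) s.2.
  apply: (sem_repeat P0) => i1 l1 m1 P1; apply: (sem_repeat P1) => i2 l2 m2 P2.
  by apply: (sem_repeat P2) => i3 l3 m3; apply: three.
split=> // t a b c ltt; apply/idP/idP; first exact: sL.
move=> dt; apply: sR => //; move: dt; rewrite /derivable /fixset.
by rewrite !card_prod !card_ord r1 add0n; congr (tab (iter _ _ _) _ _ _ _); lia.
Qed.

Lemma holds_Test r m : symmetric e -> irreflexive e -> r 1 = n -> stores_adj m ->
    (forall t a b c, t < 3 -> fact_at m t a b c = derivable e t a b c) ->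
  holds Test r m <-> has_m_convex_2cover e.
Proof.
move=> e_sym e_irr r1 mA mE; rewrite has_m_convex_2coverP // card_ord.
have -> : holds Test r m = [exists u, exists v, exists w,
      far e u v && ~~ derivable e 1 u v w] ||
    (1 < n) && [forall u, forall v, ~~ far e u v || ~~ derivable e 2 u u v].
  rewrite holds_Or holds_And; congr (_ || _ && _).
  - rewrite (holds_Ex _ _ _ r1); apply: eq_existsb => u.
    rewrite (@holds_Ex _ _ _ _ n) //; apply: eq_existsb => v.
    rewrite (@holds_Ex _ _ _ _ n) //; apply: eq_existsb => w.
    rewrite holds_And (holds_Far _ mA (i := u) (j := v)) // holds_Not.
    by rewrite (holds_Fact _ _ _ (a := u) (b := v) (c := w)) // mE.
  - by rewrite holds_Sub /= r1.
  - rewrite (holds_All _ _ _ r1); apply: eq_forallb => u.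
    rewrite (@holds_All _ _ _ _ n) //; apply: eq_forallb => v.
    rewrite holds_Or holds_Not (holds_Far _ mA (i := u) (j := v)) // holds_Not.
    by rewrite (holds_Fact _ _ _ (a := u) (b := u) (c := v)) // mE.
split.
  case/orP=> [/existsP[u /existsP[v /existsP[w uvw]]]|/andP[n1 /forallP nodd]].
    by left; exists u, v, w.
  by right; split=> // u v fuv; have /forallP/(_ v) := nodd u; rewrite fuv.
case=> [[u [v [w uvw]]]|[n1 nodd]]; apply/orP; [left|right].
  by apply/existsP; exists u; apply/existsP; exists v; apply/existsP; exists w.
rewrite n1; apply/forallP => u; apply/forallP => v.
by case: (boolP (far e u v)) => //= /nodd.
Qed.

End Correctness.

(* The square root of N in register 0 is the number of i < N with i ^ 2 < N. *)
Definition Root :=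
  Ex 3 (Not (Not (Sub (Var 0) (Ex 4 (Ex 5
    (And (Sub (Var 3) (Var 4)) (Sub (Var 3) (Var 5)))))))).

Lemma sum_ltn i N : \sum_(j < N) (j < i : nat) = minn i N.
Proof. by elim: N => [|N IHN]; rewrite ?big_ord0 ?big_ord_recr /= ?IHN; lia. Qed.

Lemma val_Root n m : val Root (input_regs (n * n) (n * n)) m = n.
Proof.
set N := n * n; set r := input_regs N N; rewrite [LHS]val_Ex.
transitivity (\sum_(i < N) (i < n : nat)); last by rewrite sum_ltn /N; nia.
apply: eq_bigr => i _; rewrite val_Not holds_Not negbK holds_Sub.
set r' := (X in val _ X); set a := Ex 4 _.
(* The machine has no multiplication: i^2 is the number of pairs j, k < i, and no pair is missed
   since i < N. *)
suff -> : val a r' m = i * i.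
  by rewrite -[val (Var 0) r' m]/N; rewrite /N !mulnn ltn_sqr.
rewrite val_Ex.
transitivity (\sum_(j < N) \sum_(k < N) (j < i) * (k < i)).
  apply: eq_bigr => j _; rewrite val_Ex; apply: eq_bigr => k _.
  rewrite val_Not /holds /= (_ : r' 3 = i) //.
  by move: (nat_of_ord i) (nat_of_ord j) (nat_of_ord k) => x y z; lia.
under eq_bigr => j _ do rewrite -big_distrr /= sum_ltn.
rewrite -big_distrl /= sum_ltn (minn_idPl _) //; exact: ltnW.
Qed.

(** * The input word as an adjacency matrix *)

Lemma nth_allpairs (S T R : Type) (f : S -> T -> R) s t x0 y0 z0 i j :
  i < size s -> j < size t ->
  nth z0 [seq f x y | x <- s, y <- t] (i * size t + j) = f (nth x0 s i) (nth y0 t j).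
Proof.
elim: s i => [|x s IHs] [|i] //= lti ltj; rewrite nth_cat size_map.
  by rewrite mul0n ltj (nth_map y0).
by rewrite ifN ?mulSn -?addnA ?addKn ?IHs // -leqNgt leq_addr.
Qed.

Lemma size_graph_code G : size (graph_code G) = nvert G * nvert G.
Proof. by rewrite size_allpairs -cardE card_ord. Qed.

Lemma nth_graph_code G (i j : 'I_(nvert G)) :
  nth false (graph_code G) (i * nvert G + j) = adj i j.
Proof.
have sz : size (enum 'I_(nvert G)) = nvert G by rewrite -cardE card_ord.
rewrite -{2}sz (nth_allpairs _ i j) ?sz // !nth_ord_enum //.
Qed.

Theorem theorem18 :
  polytime_decidable graph_code (fun G : graph => has_m_convex_2cover (@adj G)).
Proof.
(* The terms use registers up to 9 at most, so scratch registers start at 10. *)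
have rootK : regs_below 10 Root by [].
have mainK : regs_below 10 (Add Saturate Test) by [].
apply: (polytime_machine _ rootK mainK) => [|G N m]; first by [].
have NE : N = nvert G * nvert G by rewrite /N size_graph_code.
rewrite NE; set n := nvert G.
exists n; first by case: (n) => // k; rewrite leq_pmull.
split; first by rewrite sem_pure // val_Root.
have mA : stores_adj (@adj G) m by move=> i j; rewrite /m nth_graph_code.
(* Fact addresses are at least n^3 >= n^2, hence beyond the input, where memory is 0. *)
have m0 t (a b c : 'I_n) : t < 3 -> ~~ fact_at m t a b c.
  move=> _; rewrite /fact_at /m nth_default // size_graph_code /addr -/n.
  have := ltn_ord a; nia.
have r1 : input_regs (n * n) n 1 = n by [].
have [s0 sA sE] := sem_Saturate r1 mA m0.
have := holds_Test (@adj_sym G) (@adj_irr G) r1 sA sE.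
rewrite (sem_Add_zero _ s0) (sem_pure _ _ (isT : pure Test)); exact.
Qed.
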